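(* Let $m\in\mathbb N$ and $V=\mathbb N\setminus\{1,2,\dots,m\}$. Then the set $C[\bar O^1,V]$ has positive Lebesgue measure; more precisely $\lambda(C[\bar O^1,V])>\frac1{(m+1)^2}$.
   Context: Every irrational $x\in(0,1)$ has a unique expansion $x=\sum_{n\ge1}\frac{(-1)^{n-1}}{g_1(g_1+g_2)\cdots(g_1+\dots+g_n)}$ with all $g_n\in\mathbb N$; $g_n=g_n(x)$ is the $n$-th $\bar O^1$-symbol of $x$. For $V\subset\mathbb N$ nonempty, $C[\bar O^1,V]$ denotes the closure in $[0,1]$ of the set of irrational $x\in(0,1)$ with $g_k(x)\in V$ for all $k\in\mathbb N$. $\lambda$ is Lebesgue measure. *)

(* Defs.v *)
From mathcomp Require Import all_boot all_order all_algebra.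
From mathcomp Require Import all_classical all_reals all_analysis.
Set Implicit Arguments.
Unset Strict Implicit.
Unset Printing Implicit Defensive.
Import Order.TTheory GRing.Theory Num.Theory.
Import numFieldNormedType.Exports.
Local Open Scope classical_set_scope.
Local Open Scope ring_scope.

(* Sequences of symbols are indexed from 0: [g n] stands for g_{n+1}, and
   [O1_term R g n] is the (n+1)-st summand
   (-1)^n / (g_1 (g_1 + g_2) ... (g_1 + ... + g_{n+1})). *)
Definition O1_term (R : realType) (g : nat -> nat) (n : nat) : R :=
  (-1) ^+ n / (\prod_(k < n.+1) \sum_(i < k.+1) g i)%N%:R.

Definition O1_expansion (R : realType) (x : R) (g : nat -> nat) : Prop :=
  (forall n, (0 < g n)%N) /\ series (O1_term R g) @ \oo --> x.

(* Every irrational x in (0, 1) has exactly one expansion, and [O1_symbol x]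
   is then its sequence of symbols; the zero sequence is a dummy value, not a
   sequence of positive integers, for an x without expansion. *)
Definition O1_symbol (R : realType) (x : R) : nat -> nat :=
  xget (fun=> 0%N) [set g | O1_expansion x g].

(* The closure in the subspace [0, 1] is the trace on [0, 1] of the closure
   in R. *)
Definition C_O1 (R : realType) (V : set nat) : set R :=
  `[0, 1] `&`
  closure [set x : R | [/\ irrational x, 0 < x < 1 &
                           forall k, V (O1_symbol x k)]].
Arguments C_O1 R V : clear implicits.

(* Main.v *)
(* Put q_k = g_1 + ... + g_k and M = m + 1, so that the condition on the
   symbols is that all gaps of 0 = q_0 < q_1 < q_2 < ... are at least M.  Let
   W_a be the set of x whose digits satisfy this with q_0 = a instead.  The map
   x |-> 1 - q x deletes a first digit q, hence W_a is the disjoint union over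
   q >= a + M of affine copies of W_q scaled by 1/q.  The function
   u(a) = 1 / (a + 2M - 1) satisfies u(a) <= \sum_(q >= a + M) u(q) / q, and
   u(a) <= 1 / (a + M), so it bounds from below the measure of the set defined
   by the first n gap conditions, for all n, and thereby that of W_a.  At a = 0
   the bound is 1 / (2M - 1) > 1 / M^2. *)
Require Import Defs.
From mathcomp Require Import all_boot all_order all_algebra.
From mathcomp Require Import all_classical all_reals all_analysis.
From mathcomp Require Import ring lra zify.
Import Order.TTheory GRing.Theory Num.Theory.
Import numFieldNormedType.Exports.
Local Open Scope classical_set_scope.
Local Open Scope ring_scope.

(** * Lebesgue measure under affine maps *)

Lemma measurable_affine (R : realType) (b c : R) :
  measurable_fun [set: measurableTypeR R]
    (fun x : measurableTypeR R => b - c * x : measurableTypeR R).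
Proof.
apply: measurable_realfun.measurable_funB; first exact: measurable_cst.
apply: measurable_realfun.measurable_funM; first exact: measurable_cst.
exact: measurable_id.
Qed.

Lemma measurable_preimage_affine (R : realType) (b c : R) (A : set R) :
  measurable A ->
  measurable ((fun x : R => b - c * x) @^-1` A : set (measurableTypeR R)).
Proof.
move=> mA; rewrite -[X in measurable X]setTI.
exact: (measurable_affine R b c measurableT).
Qed.

(** [c] times the pushforward of Lebesgue measure agrees with Lebesgue measure on half-open
    intervals, which determine it. *)
Lemma lebesgue_measure_affine (R : realType) (b c : R) (A : set R) :
  0 < c -> measurable A ->
  lebesgue_measure ((fun x : R => b - c * x) @^-1` A) =
  (c^-1%:E * lebesgue_measure A)%E.
Proof.
move=> c0 mA.
have cge0 : 0 <= c by exact: ltW.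
pose f := (fun x : measurableTypeR R => b - c * x : measurableTypeR R).
suff -> : lebesgue_measure A =
    pushforward (mscale (NngNum cge0) lebesgue_measure) f A.
  by rewrite /pushforward /mscale/= muleA -EFinM mulVf ?gt_eqF// mul1e.
apply: lebesgue_measure_unique => // [|mf _ [[u v]] _ <-].
  exact: measurable_affine.
rewrite -[RHS]/(c%:E * lebesgue_measure (f @^-1` `]u, v]%classic))%E.
have -> : f @^-1` `]u, v] = `[(b - v) / c, (b - u) / c[%classic.
  apply/seteqP; split=> x; rewrite /= !in_itv/= /f ler_pdivrMr// ltr_pdivlMr//;
    by move=> /andP[? ?]; apply/andP; lra.
rewrite !lebesgue_measure_itv/= !lte_fin.
rewrite ltr_pM2r ?invr_gt0// ltrD2l ltrN2.
case: ifP => _; last by rewrite mule0.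
by rewrite -!EFinD -EFinM; congr EFin; field; exact: lt0r_neq0.
Qed.

(** * Sets cut out by finitely many gap conditions *)

(* The points x = 1/q_1 - 1/(q_1 q_2) + ... (Pierce's form of the expansion)
   whose digits q_k = g_1 + ... + g_k satisfy the gap condition
   q_{k+1} - q_k > m for k <= n, with q_0 = a: the tail of x after its first
   digit q is 1 - q x, and, endpoints aside, a tail is less than 1 / (a + m + 1)
   exactly when its next digit exceeds a + m. *)
Fixpoint pierce_set (R : realType) (m n a : nat) : set R :=
  if n is n'.+1 then
    \bigcup_j ((fun x => 1 - (a + m.+1 + j)%:R * x) @^-1`
                 pierce_set R m n' (a + m.+1 + j))
  else `]0, (a + m.+1)%:R^-1[.

Lemma measurable_pierce_set (R : realType) m n a :
  measurable (pierce_set R m n a : set (measurableTypeR R)).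
Proof.
elim: n a => [|n IHn] a /=; first exact: measurable_itv.
apply: bigcupT_measurable => j.
by apply: measurable_preimage_affine; exact: IHn.
Qed.

Lemma pierce_set_bounds (R : realType) m n a (x : R) :
  pierce_set R m n a x -> 0 < x /\ (a + m.+1)%:R * x < 1.
Proof.
elim: n a x => [|n IHn] a x /=.
  have q0 : (0 : R) < (a + m.+1)%:R by rewrite ltr0n; lia.
  rewrite in_itv/= => /andP[-> xlt]; split=> //.
  by rewrite mulrC -ltr_pdivlMr// div1r.
case=> j _ /IHn; set q : nat := (a + m.+1 + j)%N => -[y0 y1].
have q0 : (0 : R) < q%:R by rewrite ltr0n /q; lia.
have y1' : 1 - q%:R * x < 1.
  by apply: le_lt_trans y1; rewrite ler_peMl ?ler1n ?ltW//; lia.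
have x0 : 0 < x by rewrite -(pmulr_rgt0 _ q0); lra.
split=> //; apply: (@le_lt_trans _ _ (q%:R * x)); last by lra.
by rewrite ler_wpM2r ?ler_nat ?ltW// /q; lia.
Qed.

Lemma pierce_set_lt_invS (R : realType) m n a (x : R) :
  pierce_set R m n a x -> 0 < x /\ a.+1%:R * x < 1.
Proof.
move=> /pierce_set_bounds[x0 x1]; split=> //; apply: le_lt_trans x1.
by rewrite ler_wpM2r ?ler_nat ?ltW//; lia.
Qed.

Lemma pierce_set_subS (R : realType) m n a :
  pierce_set R m n.+1 a `<=` pierce_set R m n a.
Proof.
elim: n a => [|n IHn] a x; last by case=> j _ /IHn Hx; exists j.
move=> /pierce_set_bounds[x0 x1] /=; rewrite in_itv/= x0/=.
by rewrite -[ltRHS]mul1r ltr_pdivlMr ?ltr0n; [rewrite mulrC|lia].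
Qed.

(** For [q > 0] the two inequalities say [1/(q+1) < x < 1/q], and these intervals are disjoint;
    [q = 0] violates the second one. *)
Lemma pierce_digit_unique (R : realType) (p q : nat) (x : R) :
  0 < 1 - p%:R * x -> p.+1%:R * (1 - p%:R * x) < 1 ->
  0 < 1 - q%:R * x -> q.+1%:R * (1 - q%:R * x) < 1 -> p = q.
Proof.
wlog lt_pq : p q / (p < q)%N => [wlg p0 p1 q0 q1|p0 p1 q0 _].
  case: (ltngtP p q) => // ?; first exact: wlg.
  by apply/esym; apply: wlg.
have p_ge0 : (0 : R) <= p%:R by [].
have pq : (p.+1%:R : R) <= q%:R by rewrite ler_nat.
move: p1 pq; rewrite -natr1 => p1 pq {lt_pq}.
move: (p%:R) (q%:R) p_ge0 pq p0 p1 q0 => P Q P0 PQ p0 p1 q0.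
have x1 : 1 < (P + 1) * x by nra.
by exfalso; nra.
Qed.

Lemma trivIset_pierce (R : realType) m n a :
  trivIset [set: nat] (fun j => (fun x => 1 - (a + m.+1 + j)%:R * x) @^-1`
                                  pierce_set R m n (a + m.+1 + j)).
Proof.
apply/trivIsetP => i j _ _ ij; rewrite -subset0 => x [] /=.
move=> /pierce_set_lt_invS[i0 i1] /pierce_set_lt_invS[j0 j1].
suff : (a + m.+1 + i = a + m.+1 + j)%N by move/eqP: ij; lia.
exact: (@pierce_digit_unique R _ _ x).
Qed.

(* [u b = 1 / (b + 2m + 1)] is a subsolution of
   [u a = \sum_(q > a + m) u q / q], the equation satisfied by the measures of
   the limit sets: summed over [b >= a], the left-hand side telescopes. *)
Lemma pierce_subsolution (R : realType) (m b : nat) :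
  (b + m.*2.+1)%:R^-1 - (b.+1 + m.*2.+1)%:R^-1 <=
  (b + m.+1)%:R^-1 * (b + m.+1 + m.*2.+1)%:R^-1 :> R.
Proof.
have -> : (b + m.*2.+1)%:R^-1 - (b.+1 + m.*2.+1)%:R^-1 =
    ((b + m.*2.+1) * (b.+1 + m.*2.+1))%:R^-1 :> R.
  rewrite natrM; have -> : (b.+1 + m.*2.+1)%:R = (b + m.*2.+1)%:R + 1 :> R.
    by rewrite natr1 addSn.
  have : (0 : R) < (b + m.*2.+1)%:R by rewrite ltr0n; lia.
  by move: _%:R => y y0; field; apply/andP; split; lra.
(* This is [(b+m+1)(b+3m+2) <= (b+2m+1)(b+2m+2)]; the difference is [m^2 + m]. *)
by rewrite -invfM -natrM lef_pV2 ?posrE ?ltr0n ?ler_nat//; nia.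
Qed.

(** Induction on [n]: the slice with first digit [q] has measure at least [u q / q], and by
    [pierce_subsolution] the first [N] slices dominate the telescoping sum [u a - u (a + N)]. *)
Lemma lebesgue_measure_pierce_set (R : realType) m n a :
  ((a + m.*2.+1)%:R^-1%:E <= lebesgue_measure (pierce_set R m n a))%E.
Proof.
elim: n a => [|n IHn] a.
  rewrite /= lebesgue_measure_itv/= lte_fin invr_gt0 ltr0n ifT; last by lia.
  rewrite -EFinD subr0 lee_fin lef_pV2 ?posrE ?ltr0n ?ler_nat//; lia.
have partial N : ((a + m.*2.+1)%:R^-1%:E - (a + N + m.*2.+1)%:R^-1%:E <=
    lebesgue_measure (pierce_set R m n.+1 a))%E.
  pose F j := (fun x : R => 1 - (a + m.+1 + j)%:R * x) @^-1`
                pierce_set R m n (a + m.+1 + j).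
  have mF j : measurable (F j : set (measurableTypeR R)).
    by apply: measurable_preimage_affine; exact: measurable_pierce_set.
  apply: (@le_trans _ _
    (lebesgue_measure (\big[setU/set0]_(j < N) F j))); last first.
    apply: le_measure; rewrite ?inE.
    - exact: bigsetU_measurable.
    - exact: measurable_pierce_set.
    - by rewrite -bigcup_mkord => x [j _ Fx]; exists j.
  rewrite measure_bigsetU//; last exact: trivIset_pierce.
  elim: N => [|N IHN].
    by rewrite big_ord0 addn0 -EFinD subrr.
  rewrite big_ord_recr/=.
  have -> : ((a + m.*2.+1)%:R^-1%:E - (a + N.+1 + m.*2.+1)%:R^-1%:E =
     ((a + m.*2.+1)%:R^-1%:E - (a + N + m.*2.+1)%:R^-1%:E) +
     ((a + N + m.*2.+1)%:R^-1 - (a + N.+1 + m.*2.+1)%:R^-1)%:E :> \bar R)%E.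
    by rewrite -!EFinD; congr EFin; ring.
  apply: leeD => //.
  rewrite lebesgue_measure_affine ?ltr0n; [|lia|exact: measurable_pierce_set].
  apply: (@le_trans _ _ ((a + m.+1 + N)%:R^-1%:E *
                         (a + m.+1 + N + m.*2.+1)%:R^-1%:E)%E); last first.
    by apply: lee_pmul.
  rewrite -EFinM lee_fin (addnS a N).
  apply: le_trans (pierce_subsolution _ _ _) _.
  by rewrite (addnAC a m.+1).
apply/lee_addgt0Pr => e e0.
(* Since [N + 1 > 1/e], the remainder [u (a + N)] is at most [e]. *)
pose N := Num.truncn e^-1.
rewrite -leeBlDr//; apply: le_trans (partial N).
rewrite -!EFinB lee_fin lerD2l lerN2 -[leRHS]invrK.
rewrite lef_pV2 ?posrE ?invr_gt0 ?ltr0n//; last by lia.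
apply: le_trans (ltW (truncnS_gt _)) _.
by rewrite ler_nat -/N; lia.
Qed.

(** * Limit sets: all gap conditions at once *)

Definition pierce_limit (R : realType) m a : set R :=
  \bigcap_n pierce_set R m n a.

Lemma measurable_pierce_limit (R : realType) m a :
  measurable (pierce_limit R m a : set (measurableTypeR R)).
Proof. by apply: bigcapT_measurable => n; exact: measurable_pierce_set. Qed.

Lemma lebesgue_measure_pierce_limit (R : realType) m a :
  ((a + m.*2.+1)%:R^-1%:E <= lebesgue_measure (pierce_limit R m a))%E.
Proof.
have cvgmu : lebesgue_measure (pierce_set R m n a) @[n --> \oo] -->
    lebesgue_measure (pierce_limit R m a).
  apply: nonincreasing_cvg_mu.
  - rewrite /= lebesgue_measure_itv/=.
    by case: ifP; rewrite ?ltry// -EFinD ltry.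
  - by move=> n; exact: measurable_pierce_set.
  - exact: measurable_pierce_limit.
  - apply/nonincreasing_seqP => n; rewrite subsetEset.
    exact: pierce_set_subS.
rewrite -(cvg_lim _ cvgmu)//; apply: lime_ge.
  by apply/cvg_ex; eexists; exact: cvgmu.
by apply: nearW => n; exact: lebesgue_measure_pierce_set.
Qed.

(** The first digit could vary with the level [n]; [pierce_digit_unique] forces the one found at
    level 1 on every level. *)
Lemma pierce_limit_step (R : realType) m a (x : R) :
  pierce_limit R m a x ->
  exists2 q : nat, (a + m < q)%N & pierce_limit R m q (1 - q%:R * x).
Proof.
move=> Wx; have [j0 _ Wj0] := Wx 1%N I.
exists (a + m.+1 + j0)%N; first by lia.
move=> n _; have [j _ Wj] := Wx n.+1 I.
suff -> : (a + m.+1 + j0 = a + m.+1 + j)%N by [].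
have [i0 i1] := pierce_set_lt_invS R m 0 _ _ Wj0.
have [k0 k1] := pierce_set_lt_invS R m n _ _ Wj.
exact: (@pierce_digit_unique R _ _ x).
Qed.

(** * Pierce series and their digits *)

Definition pierce_term (R : realType) (q : nat -> nat) (n : nat) : R :=
  (-1) ^+ n / (\prod_(k < n.+1) q k)%N%:R.

Lemma series_pierceS (R : realType) (q : nat -> nat) n :
  series (pierce_term R q) n.+1 =
  (q 0%N)%:R^-1 * (1 - series (pierce_term R (q \o S)) n).
Proof.
rewrite /series/= big_nat_recl//= mulrBr mulr1; congr (_ + _).
  by rewrite /pierce_term expr0 big_ord1 mul1r.
rewrite mulr_sumr -sumrN; apply: eq_bigr => i _.
by rewrite /pierce_term big_ord_recl/= natrM invfM exprS /=; ring.
Qed.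

Lemma series_pierce_bounds (R : realType) (q : nat -> nat) n :
  (forall k, 0 < q k)%N ->
  0 <= series (pierce_term R q) n <= (q 0%N)%:R^-1.
Proof.
elim: n q => [|n IHn] q q0.
  by rewrite /series/= big_geq// lexx invr_ge0 ler0n.
have /andP[s0 s1] := IHn (q \o S) (fun k => q0 k.+1).
have i1 : ((q \o S) 0%N)%:R^-1 <= 1 :> R by rewrite invf_le1 ?ltr0n ?ler1n//=.
have qi : (0 : R) < (q 0%N)%:R^-1 by rewrite invr_gt0 ltr0n.
rewrite series_pierceS mulr_ge0 ?(ltW qi)//=; last by lra.
by rewrite ler_piMr ?(ltW qi)//; lra.
Qed.

Lemma cvg_series_pierce_shift (R : realType) (q : nat -> nat) (x : R) :
  (0 < q 0)%N -> series (pierce_term R q) @ \oo --> x ->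
  series (pierce_term R (q \o S)) @ \oo --> 1 - (q 0%N)%:R * x.
Proof.
move=> q0 cq.
have -> : series (pierce_term R (q \o S)) =
    (fun n => 1 - (q 0%N)%:R * series (pierce_term R q) n.+1).
  by apply/funext => n; rewrite series_pierceS mulVKf ?pnatr_eq0 -?lt0n// subKr.
apply: cvgB; first exact: cvg_cst.
by apply: cvgMr; move: cq; rewrite -cvg_shiftS.
Qed.

Lemma pierce_sum_bounds (R : realType) (q : nat -> nat) (x : R) :
  (forall k, 0 < q k)%N -> series (pierce_term R q) @ \oo --> x ->
  0 <= x <= (q 0%N)%:R^-1.
Proof.
move=> q0 cq.
have cvgq : cvgn (series (pierce_term R q)) by apply/cvg_ex; exists x.
rewrite -(cvg_lim _ cq)//; apply/andP; split;
  [apply: limr_ge|apply: limr_le] => //; apply: nearW => n;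
  by have /andP[] := series_pierce_bounds R q n q0.
Qed.

(** Needed to read the digits off the sum: these are the inequalities of [pierce_digit_unique]. *)
Lemma pierce_digit_bounds (R : realType) (q : nat -> nat) (x : R) :
  (forall k, 0 < q k)%N -> (forall k, q k < q k.+1)%N ->
  series (pierce_term R q) @ \oo --> x ->
  0 < 1 - (q 0%N)%:R * x /\ (q 0%N).+1%:R * (1 - (q 0%N)%:R * x) < 1.
Proof.
(* The tail [1 - p 0 * y] is at most [1 / p 1 < 1], so [y > 0]. *)
have pos (p : nat -> nat) (y : R) : (forall k, 0 < p k)%N ->
    (forall k, p k < p k.+1)%N -> series (pierce_term R p) @ \oo --> y -> 0 < y.
  move=> p0 incp cp.
  have /andP[_] := pierce_sum_bounds _ _ _ (fun k => p0 k.+1)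
    (cvg_series_pierce_shift _ _ _ (p0 0%N) cp).
  have i1 : ((p \o S) 0%N)%:R^-1 < 1 :> R.
    by rewrite invf_lt1 ?ltr0n ?ltr1n//=; have := incp 0%N; have := p0 0%N; lia.
  by move=> h; rewrite -(@pmulr_rgt0 _ (p 0%N)%:R) ?ltr0n//; lra.
move=> q0 incq cq.
have c1 := cvg_series_pierce_shift _ _ _ (q0 0%N) cq.
have c2 := cvg_series_pierce_shift _ _ _ (q0 1%N) c1.
have x1 := pos _ _ (fun k => q0 k.+1) (fun k => incq k.+1) c1.
(* Positivity of the second tail means [q 1 * (1 - q 0 * x) < 1], and [q 0 + 1 <= q 1]. *)
have x2 := pos _ _ (fun k => q0 k.+2) (fun k => incq k.+2) c2.
split=> //.
have : (q 0%N).+1%:R <= (q 1%N)%:R :> R by rewrite ler_nat.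
move: x2 => /=; rewrite -/(q 1%N) => x2 h.
by apply: (@le_lt_trans _ _ ((q 1%N)%:R * (1 - (q 0%N)%:R * x)));
  [rewrite ler_wpM2r// ltW|lra].
Qed.

Lemma pierce_sum_remainder (R : realType) (q : nat -> nat) (y : nat -> R) n :
  (forall k, 0 < q k)%N -> (forall k, y k.+1 = 1 - (q k)%:R * y k) ->
  y 0%N = series (pierce_term R q) n +
           (-1) ^+ n / (\prod_(k < n) q k)%N%:R * y n.
Proof.
move=> q0 yS; elim: n => [|n ->].
  by rewrite /series/= big_geq// big_ord0 add0r expr0 divr1 mul1r.
rewrite seriesSr -addrA; congr (_ + _).
rewrite yS /pierce_term big_ord_recr/= natrM exprS.
have qn : (q n)%:R != 0 :> R by rewrite pnatr_eq0 -lt0n.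
have pn : (\prod_(k < n) q k)%N%:R != 0 :> R.
  by rewrite pnatr_eq0 -lt0n prodn_gt0.
by field; rewrite qn pn.
Qed.

Lemma cvg_pierce_sum (R : realType) (q : nat -> nat) (y : nat -> R) :
  (forall k, k < q k)%N -> (forall k, y k.+1 = 1 - (q k)%:R * y k) ->
  (forall k, `|y k| <= 1) -> series (pierce_term R q) @ \oo --> y 0%N.
Proof.
move=> qk yS y1.
have q0 k : (0 < q k)%N by apply: leq_ltn_trans (qk k).
have err n : `|y 0%N - series (pierce_term R q) n.+1| <= harmonic n.
  rewrite {1}(pierce_sum_remainder R q y n.+1 q0 yS) addrC addKr normrM.
  rewrite normrM normrX normrN1 expr1n mul1r.
  (* The last factor [q n] alone is at least [n + 1]. *)
  have pn : (n.+1 <= \prod_(k < n.+1) q k)%N.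
    by rewrite big_ord_recr/= -[X in (X <= _)%N]mul1n leq_mul// prodn_gt0.
  rewrite normfV normr_nat -[leRHS]mulr1 ler_pM ?invr_ge0//.
  by rewrite lef_pV2 ?posrE ?ltr0n ?ler_nat//; lia.
rewrite -cvg_shiftS; apply/subr_cvg0/norm_cvg0P.
apply: squeeze_cvgr (cvg_cst 0) cvg_harmonic.
by apply: nearW => n; rewrite normr_ge0/= distrC.
Qed.

(** By uniqueness the digit from [pierce_limit_step] is [q 0]; the induction continues with the tail
    and [q 0] in place of [a]. *)
Lemma pierce_limit_digits (R : realType) m a (x : R) (q : nat -> nat) :
  (forall k, 0 < q k)%N -> (forall k, q k < q k.+1)%N ->
  series (pierce_term R q) @ \oo --> x -> pierce_limit R m a x ->
  forall k, ((if k is k'.+1 then q k' else a) + m < q k)%N.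
Proof.
move=> q0 incq cq Wx k; elim: k => [|k IHk] in q a x q0 incq cq Wx *;
  have [p ap Wp] := pierce_limit_step _ _ _ _ Wx;
  have [y0 y1] := pierce_digit_bounds _ _ _ q0 incq cq;
  have [z0 z1] := pierce_set_lt_invS R m 0 _ _ (Wp 0%N I);
  have pq : p = q 0%N by exact: (@pierce_digit_unique R _ _ x).
  by rewrite -pq.
rewrite pq in Wp.
have := IHk (q \o S) _ _ (fun k => q0 k.+1) (fun k => incq k.+1)
  (cvg_series_pierce_shift _ _ _ (q0 0%N) cq) Wp.
by case: k {IHk}.
Qed.

Lemma pierce_limit_expansion (R : realType) m a (x : R) :
  pierce_limit R m a x ->
  exists q : nat -> nat, [/\ (a < q 0)%N, forall k, (q k < q k.+1)%N &
    series (pierce_term R q) @ \oo --> x].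
Proof.
move=> Wx.
(* [F] picks the next digit from the pair (last digit, tail); off the limit sets its value is a
   dummy. *)
have /choice[F FP] : forall p : nat * R, exists q : nat,
    pierce_limit R m p.1 p.2 ->
    (p.1 + m < q)%N /\ pierce_limit R m q (1 - q%:R * p.2).
  move=> p; have [|nW] := pselect (pierce_limit R m p.1 p.2).
    by move=> /pierce_limit_step[q qp Wq]; exists q.
  by exists 0%N => /nW.
pose s n := iter n (fun p => (F p, 1 - (F p)%:R * p.2)) (a, x).
have sP n : pierce_limit R m (s n).1 (s n).2.
  by elim: n => // n /FP[].
have sF n : ((s n).1 + m < F (s n))%N by have /FP[] := sP n.
exists (F \o s); split.
- by have := sF 0%N; rewrite /=; lia.
- by move=> k; have := sF k.+1; rewrite /=; lia.
- apply: (@cvg_pierce_sum R _ (fun n => (s n).2)) => //.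
  + elim=> [|k IHk]; first by have := sF 0%N; rewrite /=; lia.
    by have := sF k.+1; move: IHk; rewrite /=; lia.
  + move=> k; have [y0 y1] := pierce_set_bounds R m 0 _ _ (sP k 0%N I).
    rewrite gtr0_norm//; apply: le_trans (ltW y1).
    by rewrite ler_peMl ?ler1n ?ltW//; lia.
Qed.

(** * Back to the symbols [g], and the measure bound *)

Lemma O1_termE (R : realType) (g : nat -> nat) :
  O1_term R g = pierce_term R (fun k => \sum_(i < k.+1) g i)%N.
Proof. by []. Qed.

Lemma O1_expansion_ex (R : realType) m (x : R) :
  pierce_limit R m 0 x -> exists g, O1_expansion x g.
Proof.
move=> /pierce_limit_expansion[q [q0 incq cq]].
exists (fun k => q k - (if k is k'.+1 then q k' else 0))%N; split.
  by case=> [|k]; rewrite subn_gt0.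
rewrite O1_termE; congr (series (pierce_term R _) @ \oo --> x): cq.
apply/funext; elim=> [|k IHk]; first by rewrite big_ord1 subn0.
by rewrite big_ord_recr/= -IHk subnKC// ltnW.
Qed.

(** Stated for every expansion [g], so that it covers the one chosen by [xget]. *)
Lemma O1_expansion_gt (R : realType) m (x : R) (g : nat -> nat) :
  pierce_limit R m 0 x -> O1_expansion x g -> forall k, (m < g k)%N.
Proof.
move=> Wx [g0]; rewrite O1_termE => cg k.
have q0 i : (0 < \sum_(j < i.+1) g j)%N.
  by rewrite big_ord_recl ltn_addr.
have incq i : (\sum_(j < i.+1) g j < \sum_(j < i.+2) g j)%N.
  by rewrite [ltnRHS]big_ord_recr/= -[ltnLHS]addn0 ltn_add2l.
have := pierce_limit_digits R m 0 x _ q0 incq cg Wx k.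
by case: k => [|k]; [rewrite big_ord1|rewrite [ltnRHS]big_ord_recr/= ltn_add2l].
Qed.

(** [C_O1] is built from irrational points, so the rational ones, a null set, are split off. *)
Lemma pierce_limit_sub (R : realType) m (V : set nat) :
  [set n | (m < n)%N] `<=` V ->
  pierce_limit R m 0 `<=` C_O1 R V `|` rational.
Proof.
move=> mV x Wx; have [Qx|irrx] := pselect (rational x); [by right|left].
have [x0 x1] := pierce_set_bounds R m 0 _ _ (Wx 0%N I).
have x1' : x < 1.
  by apply: le_lt_trans x1; rewrite ler_peMl ?ler1n ?ltW//.
split; first by rewrite /= in_itv/= !ltW.
apply: subset_closure; split=> //; first by rewrite x0.
move=> k; apply: mV; apply: (O1_expansion_gt _ _ _ _ Wx).
(* Existence of an expansion excludes the dummy value of [O1_symbol]. *)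
exact: (xgetPex _ (O1_expansion_ex _ _ _ Wx)).
Qed.

Lemma lebesgue_measure_C_O1 (R : realType) m (V : set nat) :
  [set n | (m < n)%N] `<=` V ->
  (m.*2.+1%:R^-1%:E <= lebesgue_measure (C_O1 R V))%E.
Proof.
move=> mV; apply: le_trans (lebesgue_measure_pierce_limit R m 0) _.
have mC : measurable (C_O1 R V : set (measurableTypeR R)).
  apply: measurable_realfun.closed_measurable.
  by apply: closedI; [exact: interval_closed|exact: closed_closure].
have mQ : measurable (rational : set (measurableTypeR R)).
  apply: countable_measurable => [t|]; first exact: measurable_set1.
  exact: sub_countable (card_image_le _ _) (countableP _).
have Q0 : lebesgue_measure (@rational R) = 0%E.
  exact: lebesgue_measure_rat.
apply: (@le_trans _ _ (lebesgue_measure (C_O1 R V `|` rational))).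
  apply: le_measure; rewrite ?inE//; first exact: measurable_pierce_limit.
    exact: measurableU.
  exact: pierce_limit_sub.
by rewrite measureU0.
Qed.

Theorem theorem7 (R : realType) (m : nat) (hm : (0 < m)%N) (V : set nat)
    (hV : V = [set n | (0 < n)%N] `\` [set n | (1 <= n <= m)%N]) :
  (0 < lebesgue_measure (C_O1 R V))%E /\
  ((1 / (m + 1)%:R ^+ 2)%:E < lebesgue_measure (C_O1 R V))%E.
Proof.
have mV : [set n | (m < n)%N] `<=` V.
  by move=> n /= mn; rewrite hV; split=> /=; lia.
have leC := lebesgue_measure_C_O1 R m V mV.
split; apply: lt_le_trans leC; rewrite lte_fin ?invr_gt0 ?ltr0n//.
(* [2m + 1 < (m + 1)^2] because [m > 0]. *)
by rewrite div1r -natrX ltf_pV2 ?posrE ?ltr0n ?ltr_nat ?expn_gt0; nia.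
Qed.
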